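(* Let $s\le K$ be a positive integer, $q\in[1,\infty]$, $\kappa\in(0,1/2)$ and $\rho>0$. Assume that the pair $(H,\|\cdot\|)$, with $H\in\mathbb{R}^{m\times M}$ and $\|\cdot\|$ a norm on $\mathbb{R}^M$, satisfies the condition $\mathbf{Q}_{s,q}(\kappa)$ associated with the matrix $A$ and the representation structure $\mathcal{S}$, and let $$\Xi=\{\xi\in\mathbb{R}^m:\ \|H^T(u+\xi)\|\le\rho\ \ \forall u\in\mathcal{U}\}.$$ For $y\in\mathbb{R}^m$ let the regular $\ell_1$ recovery $\widehat{x}_{\mathrm{reg}}(y)$ be any element of $$\mathop{\mathrm{Argmin}}_{v\in\mathbb{R}^n}\{L_1(Bv):\ \|H^T(Av-y)\|\le\rho\}.$$ Then for all $x\in\mathbb{R}^n$, $u\in\mathcal{U}$ and $\xi\in\Xi$, $$L_p\big(B[\widehat{x}_{\mathrm{reg}}(Ax+u+\xi)-x]\big)\le\frac{4(2s)^{1/p}}{1-2\kappa}\Big[\rho+\frac{1}{2s}L_1(Bx-[Bx]^s)\Big],\qquad 1\le p\le q.$$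
   Context: Setting: $A\in\mathbb{R}^{m\times n}$ is a given sensing matrix, and $\mathcal{U}\subset\mathbb{R}^m$ is a given compact convex set symmetric w.r.t. the origin. A representation structure (r.s.) $\mathcal{S}=(B,n_1,\dots,n_K,\|\cdot\|_{(1)},\dots,\|\cdot\|_{(K)})$ consists of positive integers $n_1,\dots,n_K$ with $N=n_1+\cdots+n_K$, a matrix $B=[B[1];\dots;B[K]]\in\mathbb{R}^{N\times n}$ (vertical concatenation, $B[k]\in\mathbb{R}^{n_k\times n}$), and norms $\|\cdot\|_{(k)}$ on $\mathbb{R}^{n_k}$. Vectors $w\in\mathbb{R}^N=\mathbb{R}^{n_1}\times\cdots\times\mathbb{R}^{n_K}$ are written in blocks $w=[w[1];\dots;w[K]]$, $w[k]\in\mathbb{R}^{n_k}$; the magnitude of block $k$ is $\|w[k]\|_{(k)}$. For $1\le p\le\infty$, $L_p(w)=\|[\|w[1]\|_{(1)};\dots;\|w[K]\|_{(K)}]\|_p$. The vector $w^s$ (also written $[w]^s$) is obtained from $w$ by zeroing out all but the $s$ blocks largest in magnitude (ties resolved arbitrarily), and $L_{s,p}(w)=L_p(w^s)$. Convention: $1/\infty=0$. Condition $\mathbf{Q}_{s,q}(\kappa)$ (for a positive integer $s\le K$, $q\in[1,\infty]$, $\kappa\ge0$) associated with $A$ and $\mathcal{S}$: a pair $(H,\|\cdot\|)$, $H\in\mathbb{R}^{m\times M}$, $\|\cdot\|$ a norm on $\mathbb{R}^M$, satisfies it if $$L_{s,q}(Bx)\le s^{1/q}\|H^TAx\|+\kappa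 s^{1/q-1}L_1(Bx)\qquad\forall x\in\mathbb{R}^n.$$ *)

(* Defs.v *)
From mathcomp Require Import all_boot all_order all_algebra.
From mathcomp Require Import all_classical all_reals all_analysis.

Set Implicit Arguments.
Unset Strict Implicit.
Unset Printing Implicit Defensive.

Import Order.TTheory GRing.Theory Num.Theory.
Local Open Scope classical_set_scope.
Local Open Scope ring_scope.

(* The library attaches norms canonically to a carrier type; here several
   arbitrary norms live on the same space, so a norm is a plain function. *)
Record is_norm (R : realType) (V : lmodType R) (N : V -> R) : Prop := IsNorm {
  norm_triangle : forall x y, N (x + y) <= N x + N y ;
  norm_homogeneous : forall (a : R) x, N (a *: x) = `|a| * N x ;
  norm_definite : forall x, N x = 0 -> x = 0 }.

(* 1/p for p in [1, +oo], using the library's (+oo)^-1 = 0. *)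
Definition expinv (R : realType) (p : \bar R) : R := fine (p^-1)%E.

(* The l_p norm on R^K, meaningful for 1 <= p <= +oo; the value at -oo is
   irrelevant. *)
Definition lp_norm (R : realType) (K : nat) (p : \bar R) (z : 'I_K -> R) : R :=
  match p with
  | r%:E => (\sum_(k < K) `|z k| `^ r) `^ r^-1
  | _ => \big[Num.max/0]_(k < K) `|z k|
  end.

(* R^N with N = n_1 + ... + n_K is 'cV[R]_(\sum_k rs_dim k); the k-th block of
   w is [submxcol w k] and concatenation of blocks is [\mxcol_k]. *)
Record rep_struct (R : realType) (n : nat) := RepStruct {
  rs_K : nat ;
  rs_dim : 'I_rs_K -> nat ;
  rs_dim_gt0 : forall k, (0 < rs_dim k)%N ;
  rs_B : 'M[R]_(\sum_(k < rs_K) rs_dim k, n) ;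
  rs_norm : forall k : 'I_rs_K, 'cV[R]_(rs_dim k) -> R ;
  rs_normP : forall k, is_norm (@rs_norm k) }.

Definition rs_vec (R : realType) (n : nat) (S : rep_struct R n) : Type :=
  'cV[R]_(\sum_(k < rs_K S) @rs_dim R n S k).

Definition block_mag (R : realType) (n : nat) (S : rep_struct R n)
    (w : rs_vec S) (k : 'I_(rs_K S)) : R :=
  rs_norm (submxcol w k).

Definition L_ (R : realType) (n : nat) (S : rep_struct R n) (p : \bar R)
    (w : rs_vec S) : R :=
  lp_norm p (block_mag w).
Arguments L_ {R n} S p w.

Definition keep_blocks (R : realType) (n : nat) (S : rep_struct R n)
    (I : {set 'I_(rs_K S)}) (w : rs_vec S) : rs_vec S :=
  \mxcol_(k < rs_K S) (if k \in I then submxcol w k else 0).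

(* [ws] is one of the possible values of w^s: when block magnitudes are tied
   there may be several admissible sets I. *)
Definition is_trunc (R : realType) (n : nat) (S : rep_struct R n) (s : nat)
    (w ws : rs_vec S) : Prop :=
  exists I : {set 'I_(rs_K S)},
    [/\ #|I| = s,
        forall i j, i \in I -> j \notin I -> block_mag w j <= block_mag w i
      & ws = keep_blocks I w].

(* A map w |-> w^s, i.e. an arbitrary rule for resolving ties. *)
Definition is_trunc_rule (R : realType) (n : nat) (S : rep_struct R n)
    (s : nat) (trunc : rs_vec S -> rs_vec S) : Prop :=
  forall w, is_trunc s w (trunc w).

Lemma trunc_rule_exists (R : realType) (n : nat) (S : rep_struct R n)
    (s : nat) : (s <= rs_K S)%N ->
  exists trunc : rs_vec S -> rs_vec S, is_trunc_rule s trunc.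
Proof.
move=> sK; suff H : forall w : rs_vec S, exists ws : rs_vec S, is_trunc s w ws.
  by exists (fun w => sval (cid (H w))) => w; exact: svalP (cid (H w)).
move=> w; suff [I [cI mI]] : exists I : {set 'I_(rs_K S)}, #|I| = s /\
    forall i j, i \in I -> j \notin I -> block_mag w j <= block_mag w i.
  by exists (keep_blocks I w), I.
elim: s sK => [|s IHs] sK.
  by exists finset.set0; split=> [|i j]; rewrite ?cards0 ?finset.in_set0.
have [I [cI mI]] := IHs (ltnW sK).
have /card_gt0P[j0 j0I] : (0 < #|finset.setC I|)%N.
  by rewrite cardsCs finset.setCK card_ord cI subn_gt0.
rewrite finset.in_setC in j0I.
case: (Order.TotalTheory.arg_maxP (P := fun j => j \notin I) (block_mag w) j0I)
  => j jI jmax.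
exists (j |: I)%SET; split.
  by rewrite cardsU1 cI jI.
move=> i l; rewrite !finset.in_setU !finset.in_set1 negb_or => iI /andP[_ lI].
by case/orP: iI => [/eqP->|iI]; [exact: jmax | exact: mI].
Qed.

(* Condition Q_{s,q}(kappa); [trunc] is w |-> w^s, so that
   [L_ S q (trunc w)] is L_{s,q}(w). *)
Definition condQ (R : realType) (m n M : nat) (A : 'M[R]_(m, n))
    (S : rep_struct R n) (s : nat) (trunc : rs_vec S -> rs_vec S)
    (q : \bar R) (kappa : R) (H : 'M[R]_(m, M)) (N : 'cV[R]_M -> R) : Prop :=
  forall x : 'cV[R]_n,
    L_ S q (trunc (rs_B S *m x)) <=
      s%:R `^ expinv q * N (H^T *m (A *m x)) +
      kappa * s%:R `^ (expinv q - 1) * L_ S 1%E (rs_B S *m x).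

Definition Xi_set (R : realType) (m M : nat) (U : set 'cV[R]_m)
    (H : 'M[R]_(m, M)) (N : 'cV[R]_M -> R) (rho : R) : set 'cV[R]_m :=
  [set xi | forall u, U u -> N (H^T *m (u + xi)) <= rho].

Definition argmin_set (R : realType) (T : Type) (F : set T) (f : T -> R) :
    set T :=
  [set v | F v /\ forall v', F v' -> f v <= f v'].

(* The set of admissible values of the regular l1 recovery at y. *)
Definition reg_recovery (R : realType) (m n M : nat) (A : 'M[R]_(m, n))
    (S : rep_struct R n) (H : 'M[R]_(m, M)) (N : 'cV[R]_M -> R) (rho : R)
    (y : 'cV[R]_m) : set 'cV[R]_n :=
  argmin_set [set v | N (H^T *m (A *m v - y)) <= rho]
             (fun v => L_ S 1%E (rs_B S *m v)).

(* Main.v *)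
Require Import Defs.
From mathcomp Require Import all_boot all_order all_algebra ring lra.
From mathcomp Require Import all_classical all_reals all_analysis.

Set Implicit Arguments.
Unset Strict Implicit.
Unset Printing Implicit Defensive.

Import Order.TTheory GRing.Theory Num.Theory.
Import numFieldNormedType.Exports.
Local Open Scope classical_set_scope.
Local Open Scope ring_scope.

(** Let $z = B(\hat x - x)$, let $J$ be the [s] blocks of $z$ kept in $z^s$, and
    put $\sigma = L_1(Bx - [Bx]^s)$.  By the definition of $\Xi$ the true signal
    is feasible for the recovery problem, which has two consequences.

    Optimality of $\hat x$ gives $L_1(B\hat x) \leq L_1(Bx)$, so the error is
    concentrated on the blocks kept in $[Bx]^s$ ([L1_error_cone]), and a fortiori
    on its own largest blocks ([sum_le_top_entries]):
    $L_1(z) \leq 2 L_{s,1}(z) + 2\sigma$.  Feasibility of both $x$ and $\hat x$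
    gives $\|H^T A(\hat x - x)\| \leq 2\rho$, so the condition on $(H, \|\cdot\|)$
    reads $L_{s,q}(z) \leq s^{1/q} c$ with $c = 2\rho + \kappa L_1(z)/s$.

    Since power means increase with the exponent ([power_mean_on_le]), the
    latter yields $L_{s,1}(z) \leq sc$.  Inserted into the former, as
    $2\kappa < 1$, this gives $L_1(z) \leq 2sT$, and then $c \leq T$, for
    $T = 2(\rho + \sigma/(2s))/(1 - 2\kappa)$.

    For $p \leq q$ the blocks in $J$ therefore contribute at most $s T^p$ to
    $L_p(z)^p$.  Every other block is at most the mean of those in $J$, hence at
    most $T$, so the others contribute at most $T^{p-1} L_1(z) \leq 2s T^p$.
    Altogether $L_p(z) \leq (3s)^{1/p} T \leq 2 (2s)^{1/p} T$
    ([lp_norm_le_of_head]), which is the asserted bound. *)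

(** * Norms and block magnitudes *)

Lemma is_norm0 (R : realType) (V : lmodType R) (N : V -> R) :
  is_norm N -> N 0 = 0.
Proof. by move=> NN; rewrite -(scale0r 0) norm_homogeneous// normr0 mul0r. Qed.

Lemma is_normN (R : realType) (V : lmodType R) (N : V -> R) x :
  is_norm N -> N (- x) = N x.
Proof.
by move=> NN; rewrite -scaleN1r norm_homogeneous// normrN1 mul1r.
Qed.

Lemma is_norm_ge0 (R : realType) (V : lmodType R) (N : V -> R) x :
  is_norm N -> 0 <= N x.
Proof.
move=> NN; have := norm_triangle NN x (- x).
by rewrite subrr is_norm0// is_normN//; lra.
Qed.

Section block_magnitudes.
Variables (R : realType) (n : nat) (S : rep_struct R n).
Implicit Types (v w : rs_vec S) (I : {set 'I_(rs_K S)}).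

Lemma block_mag_ge0 w k : 0 <= block_mag w k.
Proof. exact: is_norm_ge0 (@rs_normP _ _ S k). Qed.

Lemma block_magD v w k :
  block_mag (v + w : rs_vec S) k <= block_mag v k + block_mag w k.
Proof.
by rewrite /block_mag submxcolD; exact: norm_triangle (@rs_normP _ _ S k) _ _.
Qed.

Lemma block_magN w k : block_mag (- w : rs_vec S) k = block_mag w k.
Proof. by rewrite /block_mag submxcolN (is_normN _ (@rs_normP _ _ S k)). Qed.

Lemma block_mag_keep I w :
  block_mag (keep_blocks I w) = fun k => if k \in I then block_mag w k else 0.
Proof.
apply/funext => k; rewrite /block_mag /keep_blocks mxcolK.
by case: ifP => // _; exact: is_norm0 (@rs_normP _ _ S k).
Qed.

Lemma block_mag_drop I w :
  block_mag (w - keep_blocks I w : rs_vec S) =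
    fun k => if k \in I then 0 else block_mag w k.
Proof.
apply/funext => k; rewrite /block_mag /keep_blocks submxcolB mxcolK.
case: ifP => // _; first by rewrite subrr; exact: is_norm0 (@rs_normP _ _ S k).
by rewrite subr0.
Qed.

Lemma L1E w : L_ S 1%E w = \sum_k block_mag w k.
Proof.
rewrite /L_ /lp_norm invr1 powRr1; last first.
  by apply: sumr_ge0 => k _; exact: powR_ge0.
by apply: eq_bigr => k _; rewrite powRr1// ger0_norm// block_mag_ge0.
Qed.

Lemma L1_drop I w :
  L_ S 1%E (w - keep_blocks I w) = \sum_(k | k \notin I) block_mag w k.
Proof.
rewrite L1E [RHS]big_mkcond block_mag_drop.
by apply: eq_bigr => k _; case: ifP.
Qed.

(** On the blocks of [I] passing from [w] to [v] lowers the magnitudes by at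
    most those of [v - w], while outside [I] the magnitudes of [v - w] reappear
    in [v] up to those of [w]; hence if [v] has no larger total magnitude than
    [w], then [v - w] is concentrated on [I]. *)
Lemma L1_error_cone I v w : L_ S 1%E v <= L_ S 1%E w ->
  L_ S 1%E (v - w) <=
    2 * \sum_(k in I) block_mag (v - w : rs_vec S) k +
    2 * L_ S 1%E (w - keep_blocks I w).
Proof.
rewrite L1_drop !L1E.
have on_I : \sum_(k in I) block_mag w k <=
    \sum_(k in I) block_mag v k + \sum_(k in I) block_mag (v - w : rs_vec S) k.
  rewrite -big_split /=; apply: ler_sum => k _.
  have := block_magD v (- (v - w)) k.
  by rewrite block_magN opprB addrCA subrr addr0.
have off_I : \sum_(k | k \notin I) block_mag (v - w : rs_vec S) k <=
    \sum_(k | k \notin I) block_mag v k + \sum_(k | k \notin I) block_mag w k.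
  rewrite -big_split /=; apply: ler_sum => k _.
  by have := block_magD v (- w) k; rewrite block_magN.
rewrite (bigID (mem I) predT (block_mag v)) /=.
rewrite (bigID (mem I) predT (block_mag w)) /=.
rewrite (bigID (mem I) predT (block_mag (v - w : rs_vec S))) /=.
lra.
Qed.

End block_magnitudes.

(** * Inequalities between power sums *)

Lemma powR_pred_mul (R : realType) (x p : R) :
  0 <= x -> x != 0 -> x `^ (p - 1) * x = x `^ p.
Proof.
move=> x0 xN0; have := @powRD R x (p - 1) 1.
by rewrite xN0 implybT subrK powRr1// => ->.
Qed.

(** The convexity inequality $t^q - 1 \geq (q/p)(t^p - 1)$ for $t = a/c$,
    cleared of denominators. *)
Lemma powR_tangent (R : realType) (p q a c : R) :
  0 < p -> p <= q -> 0 <= a -> 0 < c ->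
  a `^ p <= c `^ p * (1 + p / q * (a `^ q / c `^ q - 1)).
Proof.
move=> p0 pq a0 c0; have q0 : 0 < q by exact: lt_le_trans pq.
have [<-|pNq] := eqVneq p q.
  by rewrite divff ?gt_eqF// mul1r addrC subrK mulrC divfK// gt_eqF// powR_gt0.
have {pNq}ltpq : p < q by rewrite lt_neqAle pNq.
have cq0 : 0 < c `^ q by exact: powR_gt0.
have [t t0 ->] : exists2 t, 0 <= t & a = t * c.
  by exists (a / c); rewrite ?divr_ge0 ?(ltW c0)// divfK// gt_eqF.
rewrite !powRM ?(ltW c0)// mulfK ?gt_eqF// [_ * c `^ p]mulrC.
rewrite ler_pM2l ?powR_gt0//.
(* Young's inequality for the product of t^p and 1 *)
have r0 : 0 < 1 - p / q by rewrite subr_gt0 ltr_pdivrMr// mul1r.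
have := @conjugate_powR R (t `^ p) 1 (q / p) ((1 - p / q)^-1).
rewrite powR_ge0 ler01 divr_gt0// invr_gt0 r0 invf_div invrK.
move=> /(_ isT isT isT isT); rewrite addrC subrK => /(_ erefl).
rewrite mulr1 powR1 -powRrM [p * _]mulrC divfK ?gt_eqF// mul1r => h.
by apply: le_trans h _; rewrite mulrBr; lra.
Qed.

Lemma expinv_fin (R : realType) (r : R) : r != 0 -> expinv r%:E = r^-1.
Proof. by move=> r0; rewrite /expinv inver (negbTE r0). Qed.

Lemma expinv_pinfty (R : realType) : expinv (+oo%E : \bar R) = 0.
Proof. by rewrite /expinv invey. Qed.

Section power_sums.
Variables (R : realType) (K : nat) (a : 'I_K -> R) (J : {set 'I_K}).
Hypothesis a_ge0 : forall k, 0 <= a k.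

Lemma lp_norm_pinfty_on_le c k :
  lp_norm +oo%E (fun k => if k \in J then a k else 0) <= c ->
  k \in J -> a k <= c.
Proof.
move=> hc kJ; apply: le_trans hc; rewrite /lp_norm.
by have := le_bigmax 0 (fun k => `|if k \in J then a k else 0|) k;
  rewrite /= kJ ger0_norm.
Qed.

Lemma power_sum_on_le (q c : R) : 0 < q -> 0 <= c ->
  lp_norm q%:E (fun k => if k \in J then a k else 0) <=
    #|J|%:R `^ expinv q%:E * c ->
  \sum_(k in J) a k `^ q <= #|J|%:R * c `^ q.
Proof.
move=> q0 c0; rewrite expinv_fin ?gt_eqF// /lp_norm => h.
have sumE : \sum_k `|if k \in J then a k else 0| `^ q = \sum_(k in J) a k `^ q.
  rewrite [RHS]big_mkcond; apply: eq_bigr => k _.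
  by case: ifP => _; rewrite ?normr0 ?powR0 ?gt_eqF// ger0_norm.
rewrite sumE in h.
have s0 : 0 <= \sum_(k in J) a k `^ q by apply: sumr_ge0 => k _; exact: powR_ge0.
have : ((\sum_(k in J) a k `^ q) `^ q^-1) `^ q <= (#|J|%:R `^ q^-1 * c) `^ q.
  by apply: ge0_ler_powR; rewrite ?nnegrE ?powR_ge0 ?mulr_ge0 ?powR_ge0// ltW.
by rewrite powRM ?powR_ge0// -!powRrM mulVf ?gt_eqF// !powRr1.
Qed.

(** The power mean over [J] is nondecreasing in the exponent: summing
    [powR_tangent] over [J], the bracket averages to at most $1$. *)
Lemma power_mean_on_le (q : \bar R) (p c : R) : 0 < p -> (p%:E <= q)%E -> 0 < c ->
  lp_norm q (fun k => if k \in J then a k else 0) <= #|J|%:R `^ expinv q * c ->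
  \sum_(k in J) a k `^ p <= #|J|%:R * c `^ p.
Proof.
move=> p0 + c0; case: q => [q||].
- rewrite lee_fin => pq h; have q0 : 0 < q by exact: lt_le_trans pq.
  have {}h := power_sum_on_le q0 (ltW c0) h.
  have cq0 : 0 < c `^ q by exact: powR_gt0.
  apply: (@le_trans _ _
    (\sum_(k in J) c `^ p * (1 + p / q * (a k `^ q / c `^ q - 1)))).
    by apply: ler_sum => k _; exact: powR_tangent.
  rewrite -mulr_sumr mulrC ler_pM2r ?powR_gt0//.
  rewrite big_split /= sumr_const -mulr_sumr big_split /= -mulr_suml sumr_const.
  rewrite mulNrn gerDl pmulr_rle0 ?divr_gt0// subr_le0.
  by rewrite ler_pdivrMr.
- rewrite expinv_pinfty powRr0 mul1r => _ h.
  rewrite mulrC mulr_natr -sumr_const; apply: ler_sum => k kJ.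
  by apply: ge0_ler_powR; rewrite ?nnegrE ?(ltW p0) ?(ltW c0)//;
    exact: lp_norm_pinfty_on_le.
- by [].
Qed.

(** Outside [J] every entry is at most $T$, so there
    $a_k^p \leq T^{p-1} a_k$ and the tail costs at most $T^{p-1}$ times the sum
    of the entries. *)
Lemma power_sum_le_head_tail (p T : R) : 1 <= p -> 0 < T ->
  (forall k, k \notin J -> a k <= T) ->
  \sum_k a k `^ p <= \sum_(k in J) a k `^ p + T `^ (p - 1) * \sum_k a k.
Proof.
move=> p1 T0 tail; rewrite (bigID (mem J)) /= lerD2l.
apply: (@le_trans _ _ (\sum_(k | k \notin J) T `^ (p - 1) * a k)); last first.
  rewrite -mulr_sumr ler_wpM2l ?powR_ge0//.
  by rewrite [leRHS](bigID (mem J)) /= lerDr sumr_ge0.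
apply: ler_sum => k kJ; have [->|ak0] := eqVneq (a k) 0.
  by rewrite mulr0 powR0// gt_eqF// (lt_le_trans ltr01).
have -> : a k `^ p = a k `^ (p - 1) * a k by rewrite powR_pred_mul.
rewrite ler_wpM2r//.
by apply: ge0_ler_powR; rewrite ?nnegrE ?subr_ge0 ?(ltW T0)// tail.
Qed.

End power_sums.

(** Exchange argument: [I] and [J] have equally many elements outside of each
    other, and every entry on [I :\: J] is below every entry on [J :\: I].
    Summing over all pairs avoids choosing a smallest entry of [J]. *)
Lemma sum_le_top_entries (R : realType) (K : nat) (a : 'I_K -> R)
    (I J : {set 'I_K}) :
  #|I| = #|J| -> (forall i j, i \in J -> j \notin J -> a j <= a i) ->
  \sum_(k in I) a k <= \sum_(k in J) a k.
Proof.
move=> cIJ Jmax.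
rewrite (big_setID J) /= [leRHS](big_setID I) /= finset.setIC lerD2l.
have cD : #|(I :\: J)%SET| = #|(J :\: I)%SET|.
  by rewrite !cardsD finset.setIC cIJ.
have [IJ0|IJ0] := eqVneq #|(I :\: J)%SET| 0%N.
  by rewrite (cards0_eq IJ0) (@cards0_eq _ (J :\: I)%SET) -?cD// !big_set0.
rewrite -(@ler_pM2l _ #|(I :\: J)%SET|%:R) ?ltr0n ?lt0n//.
have -> : #|(I :\: J)%SET|%:R * (\sum_(k in (J :\: I)%SET) a k) =
    \sum_(i in (J :\: I)%SET) \sum_(k in (I :\: J)%SET) a i.
  by rewrite exchange_big /= sumr_const mulr_natl.
rewrite cD mulr_natl -sumr_const; apply: ler_sum => i iJ; apply: ler_sum => k kI.
by move: iJ kI; rewrite !finset.in_setD => /andP[_ iJ] /andP[kJ _]; exact: Jmax.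
Qed.

(** In an $\ell_p$ norm, $3s$ terms of size $T$ in place of $2s$ of them cost
    at most a factor $2$, since $3s \leq 2 \cdot 2s$ and $2^{1/p} \leq 2$. *)
Lemma powR_inv_le_double (R : realType) (p s T X : R) :
  1 <= p -> 0 < s -> 0 < T -> 0 <= X -> X <= 3 * s * T `^ p ->
  X `^ p^-1 <= 2 * (2 * s) `^ p^-1 * T.
Proof.
move=> p1 s0 T0 X0 XT; have p0 : 0 < p by exact: lt_le_trans p1.
apply: (@le_trans _ _ ((2 * (2 * s) * T `^ p) `^ p^-1)).
  apply: ge0_ler_powR; rewrite ?nnegrE ?invr_ge0 ?(ltW p0)//.
    by rewrite !mulr_ge0 ?powR_ge0// ltW.
  by apply: (le_trans XT); rewrite ler_pM2r ?powR_gt0//; lra.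
rewrite powRM ?powR_ge0 ?mulr_ge0 ?(ltW s0)//.
rewrite powRM ?mulr_ge0 ?(ltW s0)// -powRrM mulfV ?gt_eqF// powRr1 ?(ltW T0)//.
rewrite ler_pM2r// ler_pM2r ?powR_gt0 ?mulr_gt0//.
rewrite -[leRHS]powRr1//; apply: ler_powR; first by rewrite ler1n.
by rewrite invf_le1.
Qed.

(** The power mean inequality controls the head in every exponent up to $q$;
    with exponent $1$ it bounds the mean of the entries on [J], hence every
    entry of the tail, by $T$.  The $1$-norm bound then pays for the tail. *)
Lemma lp_norm_le_of_head (R : realType) (K : nat) (a : 'I_K -> R)
    (J : {set 'I_K}) (p q : \bar R) (T : R) :
  (forall k, 0 <= a k) -> (0 < #|J|)%N ->
  (forall i j, i \in J -> j \notin J -> a j <= a i) ->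
  (1 <= p)%E -> (p <= q)%E -> 0 < T ->
  lp_norm q (fun k => if k \in J then a k else 0) <= #|J|%:R `^ expinv q * T ->
  \sum_k a k <= 2 * #|J|%:R * T ->
  lp_norm p a <= 2 * (2 * #|J|%:R) `^ expinv p * T.
Proof.
move=> a0 J0 Jmax p1 pq T0 head total.
have s0 : 0 < #|J|%:R :> R by rewrite ltr0n.
have tail k : k \notin J -> a k <= T.
  move=> kJ; have := power_mean_on_le a0 ltr01 (le_trans p1 pq) T0 head.
  rewrite powRr1 ?(ltW T0)// => h.
  rewrite -(ler_pM2l s0); apply: le_trans h.
  rewrite mulrC mulr_natr -sumr_const; apply: ler_sum => i iJ.
  by rewrite powRr1// Jmax.
case: p p1 pq => [p||] p1 pq.
- rewrite lee_fin in p1; have p0 : 0 < p by exact: lt_le_trans p1.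
  rewrite expinv_fin ?gt_eqF// /lp_norm.
  have -> : \sum_k `|a k| `^ p = \sum_k a k `^ p.
    by apply: eq_bigr => k _; rewrite ger0_norm.
  apply: powR_inv_le_double => //.
    by apply: sumr_ge0 => k _; exact: powR_ge0.
  have h1 := power_sum_le_head_tail a0 p1 T0 tail.
  have h2 := power_mean_on_le a0 p0 pq T0 head.
  have h3 : T `^ (p - 1) * \sum_k a k <= 2 * #|J|%:R * T `^ p.
    by rewrite -(powR_pred_mul p (ltW T0)) ?gt_eqF// mulrCA ler_pM2l ?powR_gt0.
  lra.
- rewrite expinv_pinfty powRr0 mulr1 /lp_norm.
  move: pq head; rewrite leye_eq => /eqP ->.
  rewrite expinv_pinfty powRr0 mul1r => head.
  apply: bigmax_le => [|k _]; first by rewrite mulr_ge0// ltW.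
  rewrite ger0_norm//; apply: (@le_trans _ _ T); last by lra.
  have [kJ|/tail//] := boolP (k \in J).
  exact: lp_norm_pinfty_on_le head kJ.
- by [].
Qed.

(** * Recovery error *)

(** Substituting the bound on the head mass [h] into the cone inequality
    yields $\ell \leq 4 s \rho + 2\kappa\ell + 2\sigma$ for the total mass
    $\ell$, whose own multiple on the right is absorbed because $2\kappa < 1$. *)
Lemma cone_and_head_bounds (R : realType) (s kappa rho sigma l h : R) :
  0 < s -> 0 < kappa -> kappa < 1 / 2 -> 0 < rho -> 0 <= sigma ->
  l <= 2 * h + 2 * sigma -> h <= s * (2 * rho + kappa * (l / s)) ->
  let T := 2 * (rho + sigma / (2 * s)) / (1 - 2 * kappa) in
  [/\ 0 < T, l <= 2 * s * T & 2 * rho + kappa * (l / s) <= T].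
Proof.
move=> s0 kappa0 kappa_lt rho0 sigma0 cone head T.
have k1 : 0 < 1 - 2 * kappa by lra.
have TE : (1 - 2 * kappa) * T = 2 * rho + sigma / s.
  by rewrite /T; field; rewrite !gt_eqF.
have T0 : 0 < T.
  by rewrite divr_gt0// mulr_gt0// ltr_wpDr// divr_ge0// mulr_ge0// ltW.
have lT : l <= 2 * s * T.
  have {}head : h <= 2 * rho * s + kappa * l.
    by apply: (le_trans head); rewrite le_eqVlt; apply/orP; left;
      apply/eqP; field; rewrite gt_eqF.
  have sTE : (1 - 2 * kappa) * (2 * s * T) = 4 * rho * s + 2 * sigma.
    have -> : (1 - 2 * kappa) * (2 * s * T) =
      2 * s * ((1 - 2 * kappa) * T) by ring.
    by rewrite TE; field; rewrite gt_eqF.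
  by rewrite -(ler_pM2l k1) sTE; lra.
split=> //.
have : kappa * (l / s) <= kappa * (2 * T).
  by rewrite ler_pM2l// ler_pdivrMr// mulrAC.
have : 0 <= sigma / s by rewrite divr_ge0// ltW.
lra.
Qed.

Lemma bound_constantE (R : realType) (s kappa rho sigma g : R) :
  4 * g / (1 - 2 * kappa) * (rho + 1 / (2 * s) * sigma) =
  2 * g * (2 * (rho + sigma / (2 * s)) / (1 - 2 * kappa)).
Proof. by rewrite div1r [(2 * s)^-1 * _]mulrC; ring. Qed.

Theorem theorem3p1 (R : realType) (m n M : nat)
    (A : 'M[R]_(m, n)) (U : set 'cV[R]_m)
    (U_compact : compact U) (U_convex : convex_set U)
    (U_symmetric : forall u, U u -> U (- u))
    (S : rep_struct R n) (s : nat) (s_gt0 : (0 < s)%N) (s_le_K : (s <= rs_K S)%N)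
    (trunc : rs_vec S -> rs_vec S) (truncP : is_trunc_rule s trunc)
    (q : \bar R) (q_ge1 : (1 <= q)%E)
    (kappa : R) (kappa_gt0 : 0 < kappa) (kappa_lt : kappa < 1 / 2)
    (rho : R) (rho_gt0 : 0 < rho)
    (H : 'M[R]_(m, M)) (N : 'cV[R]_M -> R) (N_norm : is_norm N)
    (HQ : condQ A s trunc q kappa H N) :
  forall (x : 'cV[R]_n) (u xi : 'cV[R]_m), U u -> Xi_set U H N rho xi ->
  forall xhat : 'cV[R]_n, reg_recovery A S H N rho (A *m x + u + xi) xhat ->
  forall p : \bar R, (1 <= p)%E -> (p <= q)%E ->
    L_ S p (rs_B S *m (xhat - x)) <=
      4 * (2 * s%:R) `^ expinv p / (1 - 2 * kappa) *
      (rho + 1 / (2 * s%:R) *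
             L_ S 1%E (rs_B S *m x - trunc (rs_B S *m x))).
Proof.
move=> x u xi Uu Xixi xhat [feas opt] p p1 pq.
set y := A *m x + u + xi in feas opt.
have s0 : 0 < s%:R :> R by rewrite ltr0n.
have [I [cI _ xI]] := truncP (rs_B S *m x).
have [J [cJ Jmax zJ]] := truncP (rs_B S *m (xhat - x)).
set z := rs_B S *m (xhat - x) in Jmax zJ *.
set sigma := L_ S 1%E (rs_B S *m x - trunc (rs_B S *m x)).
have sigma0 : 0 <= sigma.
  by rewrite /sigma L1E; apply: sumr_ge0 => k _; exact: block_mag_ge0.
have yE : A *m x - y = - (u + xi) by rewrite /y -addrA opprD addNKr.
have x_feas : N (H^T *m (A *m x - y)) <= rho.
  by rewrite yE mulmxN is_normN//; exact: Xixi.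
have L1_decr : L_ S 1%E (rs_B S *m xhat) <= L_ S 1%E (rs_B S *m x) by exact: opt.
have residual : N (H^T *m (A *m (xhat - x))) <= 2 * rho.
  have -> : A *m (xhat - x) = (A *m xhat - y) - (A *m x - y).
    by rewrite opprB addrA subrK mulmxBr.
  rewrite mulmxBr; apply: (le_trans (norm_triangle N_norm _ _)).
  by rewrite is_normN// mulr_natl mulr2n lerD.
have z_ge0 k : 0 <= block_mag z k by exact: block_mag_ge0.
have L1z0 : 0 <= L_ S 1%E z by rewrite L1E; exact: sumr_ge0.
have cone :
    L_ S 1%E z <= 2 * \sum_(k in J) block_mag z k + 2 * sigma.
  have zE : z = rs_B S *m xhat - rs_B S *m x by rewrite /z mulmxBr.
  have := L1_error_cone I L1_decr; rewrite -xI -zE -/sigma => h.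
  apply: le_trans h _; rewrite lerD2r ler_pM2l//.
  by apply: sum_le_top_entries => //; rewrite cI cJ.
pose c := 2 * rho + kappa * (L_ S 1%E z / s%:R).
have c0 : 0 < c.
  by rewrite ltr_wpDr ?mulr_gt0// mulr_ge0 ?(ltW kappa_gt0)// divr_ge0// ltW.
have head : lp_norm q (fun k => if k \in J then block_mag z k else 0) <=
    #|J|%:R `^ expinv q * c.
  rewrite cJ -(block_mag_keep J z) -zJ; apply: le_trans (HQ (xhat - x)) _.
  have -> : s%:R `^ (expinv q - 1) = s%:R `^ expinv q / s%:R :> R.
    by rewrite -(powR_pred_mul (expinv q) (ltW s0)) ?gt_eqF// mulfK ?gt_eqF.
  rewrite -/z /c mulrDr; apply: lerD; first by rewrite ler_pM2l ?powR_gt0.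
  by rewrite [kappa * (_ / _)]mulrCA -!mulrA [_^-1 * _]mulrC.
have S_J : \sum_(k in J) block_mag z k <= s%:R * c.
  have := power_mean_on_le z_ge0 ltr01 q_ge1 c0 head.
  by rewrite cJ powRr1 ?(ltW c0)//; under eq_bigr do rewrite powRr1//.
pose T := 2 * (rho + sigma / (2 * s%:R)) / (1 - 2 * kappa).
have [T0 L1z cT] : [/\ 0 < T, L_ S 1%E z <= 2 * s%:R * T & c <= T].
  exact: cone_and_head_bounds cone S_J.
rewrite bound_constantE -/T -cJ.
apply: (@lp_norm_le_of_head _ _ _ J p q) => //.
- by rewrite cJ.
- by apply: (le_trans head); rewrite ler_wpM2l ?powR_ge0.
- by rewrite cJ -L1E.
Qed.
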